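(* Let $\psi:\mathbb{N}\to\mathbb{R}^+$ be an arbitrary function with $\lim_{n\to\infty}\psi(n)=\infty$, and let $$E(\psi)=\Big\{x\in(0,1]:\lim_{n\to\infty}\frac{\log d_n(x)}{\psi(n)}=1\Big\}.$$ Then $\dim_H E(\psi)=\frac{1}{2+\eta}$, where $$\eta=\limsup_{n\to\infty}\frac{\psi(n+1)}{\psi(1)+\cdots+\psi(n)}.$$
   Context: Lüroth expansion: the Lüroth map $T:(0,1]\to(0,1]$ is $T(x)=d_1(x)(d_1(x)-1)\big(x-\frac{1}{d_1(x)}\big)$ with $d_1(x)=\lfloor 1/x\rfloor+1$, and the digits are $d_n(x)=d_1(T^{n-1}(x))$ for $n\ge2$. Every $x\in(0,1]$ then has the expansion $x=\frac{1}{d_1}+\frac{1}{d_1(d_1-1)d_2}+\cdots+\frac{1}{d_1(d_1-1)\cdots d_{n-1}(d_{n-1}-1)d_n}+\cdots$ with all digits $d_n(x)\ge2$. Here $\log$ is the natural logarithm and $\dim_H$ denotes Hausdorff dimension. $\eta\in[0,\infty]$, with $\frac{1}{2+\eta}$ read as $0$ when $\eta=\infty$. *)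

(* Defs.v *)
From HB Require Import structures.
From mathcomp Require Export all_boot all_order all_algebra.
From mathcomp Require Export all_classical all_reals all_analysis.
Export Order.TTheory GRing.Theory Num.Theory.
Export numFieldNormedType.Exports.

Set Implicit Arguments.
Unset Strict Implicit.
Unset Printing Implicit Defensive.

Local Open Scope classical_set_scope.
Local Open Scope ring_scope.

Section hausdorff.
Context {R : realType}.
Local Open Scope ereal_scope.
Implicit Types (A U : set R) (s delta : R).

(* Equals -oo when U is empty. *)
Definition ediam U : \bar R :=
  ereal_sup [set `|x - y|%:E | x in U & y in U].

(* |U|^s, with the usual convention that the empty set contributes 0 for every
   s >= 0 while a singleton contributes 1 for s = 0. *)
Definition ediam_pow s U : \bar R :=
  if U == set0 then 0 else ediam U `^ s.

Definition delta_cover delta A (U : nat -> set R) : Prop :=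
  A `<=` \bigcup_i U i /\ forall i, ediam (U i) <= delta%:E.

Definition hausdorff_premeasure s delta A : \bar R :=
  ereal_inf [set \sum_(0 <= i <oo) ediam_pow s (U i)
            | U in [set U | delta_cover delta A U]].

Definition hausdorff_measure s A : \bar R :=
  ereal_sup [set hausdorff_premeasure s delta A
            | delta in [set delta : R | (0 < delta)%R]].

Definition hausdorff_dim A : \bar R :=
  ereal_inf [set s%:E | s in
    [set s : R | (0 <= s)%R /\ hausdorff_measure s A = 0]].

End hausdorff.

Section luroth.
Context {R : realType}.
Implicit Types (x : R) (n : nat) (psi : nat -> R).

(* On ]0, 1] the inverse of x is positive, so Num.truncn is the floor. *)
Definition luroth_d1 x : nat := (Num.truncn x^-1).+1.

(* The Lüroth map, extended by the same formula outside ]0, 1]. *)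
Definition luroth_map x : R :=
  (luroth_d1 x)%:R * ((luroth_d1 x)%:R - 1) * (x - (luroth_d1 x)%:R^-1).

(* Digits are indexed from 1; the value at n = 0 is irrelevant. *)
Definition luroth_digit n x : nat := luroth_d1 (iter n.-1 luroth_map x).

Definition luroth_E psi : set R :=
  [set x | 0 < x <= 1 /\
    ln (luroth_digit n x)%:R / psi n @[n --> \oo] --> (1 : R)].

End luroth.

(* Main.v *)
From mathcomp Require Import ring lra.
Require Import Defs.

(* Write S_n = psi(1) + ... + psi(n).

   Upper bound.  A point of E(psi) has digits with
   |ln d_k - psi(k)| <= eps psi(k) + C for some C and all k.  For fixed C, the
   cylinders of order n that meet this set number about exp(S_n), and since
   d_{n+1} is also large only a piece of length about exp(-2 S_n - psi(n+1)) of
   each is needed.  As psi tends to infinity, S_n / n does too, so the factors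
   exp(O(n)) are negligible, and the exponent
   liminf S_n / (2 S_n + psi(n+1)) = 1 / (2 + eta) comes out.

   Lower bound.  Let m_k be about exp(psi(k)).  The digits c_k < m_k of a number
   t in [0, 1[ in the mixed radix (m_k) yield the point f(t) of E(psi) with
   Lüroth digits m_k + c_k.  If t and u first differ at place n + 1, by j, then
   |t - u| <= 2 j / (m_1 ... m_{n+1}), whereas |f(t) - f(u)| is at least
   j exp(-2 S_{n+1} - O(n)).  Hence the inverse of f is s-Hölder for
   s < 1 / (2 + eta), and covers of E(psi) are pulled back to covers of
   [0, 1[, whose Lebesgue measure is 1. *)

Set Implicit Arguments.
Unset Strict Implicit.
Unset Printing Implicit Defensive.

Local Open Scope classical_set_scope.
Local Open Scope ring_scope.

(** * Bounds on Hausdorff measures *)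

Section hausdorff_bounds.
Context {R : realType}.
Local Open Scope ereal_scope.
Implicit Types (A U : set R) (s delta D : R).

Lemma ediam_pow_ge0 s U : 0 <= ediam_pow s U.
Proof. by rewrite /ediam_pow; case: ifP => // _; exact: poweR_ge0. Qed.

Lemma ediam_ge0 U : U !=set0 -> 0 <= ediam U.
Proof.
move=> [x Ux]; apply: ereal_sup_ubound; exists x => //; exists x => //.
by rewrite subrr normr0.
Qed.

Lemma ediam_le U D : (forall x y, U x -> U y -> `|x - y| <= D)%R ->
  ediam U <= D%:E.
Proof.
by move=> UD; apply: ge_ereal_sup => _ [x Ux [y Uy <-]]; rewrite lee_fin UD.
Qed.

Lemma ediam_pow_le s D U : (0 <= s)%R -> (0 <= D)%R ->
  (forall x y, U x -> U y -> `|x - y| <= D)%R -> ediam_pow s U <= (D `^ s)%:E.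
Proof.
move=> s0 D0 UD; rewrite /ediam_pow; case: ifPn => [_|/set0P U0].
  by rewrite lee_fin powR_ge0.
rewrite -poweR_EFin; apply: gt0_ler_poweR => //.
- by rewrite in_itv/= leey andbT ediam_ge0.
- by rewrite in_itv/= leey andbT lee_fin.
- exact: ediam_le.
Qed.

Lemma hausdorff_premeasure_ge0 s delta A : 0 <= hausdorff_premeasure s delta A.
Proof.
apply: le_ereal_inf_tmp => _ [U _ <-]; apply: nneseries_ge0 => i _ _.
exact: ediam_pow_ge0.
Qed.

(** The list is padded with [set0], which [ediam_pow] counts as 0 even for s = 0. *)
Lemma hausdorff_premeasure_finite_cover s delta D A (l : seq (set R)) :
  (0 <= s)%R -> (0 <= D <= delta)%R ->
  (forall U, U \in l -> forall x y, U x -> U y -> `|x - y| <= D)%R ->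
  (forall x, A x -> exists2 U, U \in l & U x) ->
  hausdorff_premeasure s delta A <= ((size l)%:R * D `^ s)%:E.
Proof.
move=> s0 /andP[D0 Ddelta] lD Al.
have nthD i x y : nth set0 l i x -> nth set0 l i y -> (`|x - y| <= D)%R.
  by case: (ltnP i (size l)) => [il|il]; [exact/lD/mem_nth|rewrite nth_default].
apply: (@le_trans _ _ (\sum_(0 <= i <oo) ediam_pow s (nth set0 l i))).
  apply: ereal_inf_lbound; exists (nth set0 l) => //; split.
    move=> x /Al[U Ul Ux]; exists (index U l) => //.
    by rewrite nth_index.
  move=> i; apply: (@le_trans _ _ D%:E); last by rewrite lee_fin.
  by apply: ediam_le => x y; exact: nthD.
rewrite (nneseries_split 0 (size l)); last by move=> k _; exact: ediam_pow_ge0.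
rewrite add0n eseries0 ?adde0; last first.
  by move=> i il _; rewrite nth_default// /ediam_pow eqxx.
apply: (@le_trans _ _ (\sum_(0 <= i < size l) (D `^ s)%:E)).
  by apply: lee_sum => i _; apply: ediam_pow_le => //; exact: nthD.
by rewrite sumEFin sumr_const_nat subn0 mulr_natl lexx.
Qed.

Lemma hausdorff_premeasure_bigcup0 s delta (A : nat -> set R) :
  (forall k, hausdorff_premeasure s delta (A k) = 0) ->
  hausdorff_premeasure s delta (\bigcup_k A k) = 0.
Proof.
move=> A0; apply/eqP; rewrite eq_le hausdorff_premeasure_ge0 andbT.
apply/lee_addgt0Pr => e e0; rewrite add0e.
pose P n (B : nat -> set R) := delta_cover delta (A n) B /\
  \sum_(0 <= k <oo) ediam_pow s (B k) <= (e / (2 ^ n.+1)%:R)%:E.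
have [G PG] : {G : nat -> nat -> set R & forall n, P n (G n)}.
  apply: (@choice _ _ P) => n; rewrite /P.
  have en : (0 < e / (2 ^ n.+1)%:R)%R by rewrite divr_gt0// ltr0n expn_gt0.
  have fin : hausdorff_premeasure s delta (A n) \is a fin_num by rewrite A0.
  have [_ [B AB <-] /ltW] := lb_ereal_inf_adherent en fin.
  by rewrite -/(hausdorff_premeasure _ _ _) A0 add0e; exists B.
pose g (ij : nat * nat) := ediam_pow s (G ij.1 ij.2).
have g0 ij : 0 <= g ij by exact: ediam_pow_ge0.
apply: (@le_trans _ _ (\esum_(i in setT) g i)).
  apply: ereal_inf_lbound => /=.
  (* [f] enumerates the pairs of indices and so merges countably many covers into one. *)
  have /card_esym/ppcard_eqP[f] := card_nat2.
  exists (fun i => G (f i).1 (f i).2).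
    split; last by move=> i; exact: (PG _).1.2.
    move=> t [i _] /((PG i).1.1)[j _ Gt]; exists (f^-1%FUN (i, j)) => //=.
    by rewrite invK ?inE.
  rewrite -(esum_pred_image g f xpredT) ?[fun=> _]set_true//.
  by rewrite image_eq.
rewrite (_ : esum _ _ = \sum_(0 <= i <oo) \sum_(0 <= j <oo) g (i, j)); last first.
  pose J : nat -> set (nat * nat) := fun i => [set (i, j) | j in setT].
  rewrite (_ : setT = \bigcup_k J k); last first.
    by rewrite predeqE => -[a b]; split => // _; exists a => //; exists b.
  rewrite esum_bigcupT //=; last first.
    apply/trivIsetP => i j _ _ ij.
    rewrite predeqE => -[n m] /=; split => //= -[] [_] _ [<-{n} _].
    by move=> [m' _] [] /esym/eqP; rewrite (negbTE ij).
  rewrite -nneseries_esumT; last by move=> n; exact: esum_ge0.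
  apply: eq_eseriesr => /= j _.
  rewrite -(esum_pred_image g (pair j) predT)//=; last first.
    by move=> ? ? _ _; exact: (@can_inj _ _ _ snd).
  by congr esum; rewrite predeqE => -[a b]; split; move=> [i _ <-]; exists i.
apply: le_trans (epsilon_trick0 xpredT (ltW e0)).
apply: lee_nneseries => [i _ _|i _]; first by apply: nneseries_ge0 => j *.
exact: (PG i).2.
Qed.

Lemma hausdorff_measure_eq0 s A :
  (forall delta, (0 < delta)%R -> hausdorff_premeasure s delta A = 0) ->
  hausdorff_measure s A = 0.
Proof.
move=> A0; apply/eqP; rewrite eq_le; apply/andP; split.
  by apply: ge_ereal_sup => _ [d d0 <-]; rewrite A0.
by apply: ereal_sup_ubound; exists 1%R => //=; rewrite A0.
Qed.

(* The preimages under [f] of the members of a cover lie in intervals that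
   cover [0, 1[, whose total length is at least 1. *)
Lemma hausdorff_measure_neq0 s (c : R) A (f : R -> R) : (0 <= s)%R -> (0 < c)%R ->
  (forall t : R, (0 <= t < 1)%R -> A (f t)) ->
  (forall t u : R, (0 <= t < 1)%R -> (0 <= u < 1)%R ->
    (`|t - u| <= c * `|f t - f u| `^ s)%R) ->
  hausdorff_measure s A != 0.
Proof.
move=> s0 c0 Af fs.
(* One scale suffices, as the measure is a supremum over all scales; [delta] = 1 serves to keep the
   diameters finite. The bound 1 / (2c) arises because [0, 1[ has length 1 and each interval below
   has length at most 2c |U|^s. *)
suff : ((c *+ 2)^-1)%:E <= hausdorff_premeasure s 1 A.
  move=> cA; rewrite gt_eqF//; apply: (@lt_le_trans _ _ ((c *+ 2)^-1)%:E).
    by rewrite lte_fin invr_gt0 pmulrn_lgt0.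
  by apply: (le_trans cA); apply: ereal_sup_ubound; exists 1%R => //=.
apply: le_ereal_inf_tmp => _ [U [AU U1] <-].
(* If [U i] contains some f(t0), every t with f(t) in [U i] lies within c |U i|^s of t0. *)
have [I UI] : {I : nat -> set R & forall i, [/\ measurable (I i),
    (forall t : R, (0 <= t < 1)%R -> U i (f t) -> I i t) &
    lebesgue_measure (I i) <= (c *+ 2)%:E * ediam_pow s (U i)]}.
  apply: (@choice _ _ (fun i J => [/\ measurable J,
    (forall t : R, (0 <= t < 1)%R -> U i (f t) -> J t) &
    lebesgue_measure J <= (c *+ 2)%:E * ediam_pow s (U i)])) => i.
  have [[t0 [t01 Ut0]]|Ut] := pselect (exists t : R, (0 <= t < 1)%R /\ U i (f t)).
    have U0 : U i !=set0 by exists (f t0).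
    have fin : ediam (U i) \is a fin_num.
      by rewrite ge0_fin_numE ?ediam_ge0// (le_lt_trans (U1 i)) ?ltry.
    have D0 := ediam_ge0 U0.
    have fD x y : U i x -> U i y -> (`|x - y| <= fine (ediam (U i)))%R.
      move=> Ux Uy; rewrite -lee_fin fineK//; apply: ereal_sup_ubound.
      by exists x => //; exists y.
    have -> : ediam_pow s (U i) = (fine (ediam (U i)) `^ s)%:E.
      rewrite /ediam_pow ifF; last exact/negbTE/set0P.
      by rewrite -poweR_EFin fineK.
    set r := (c * fine (ediam (U i)) `^ s)%R.
    have r0 : (0 <= r)%R by rewrite mulr_ge0 ?powR_ge0// ltW.
    exists `[(t0 - r)%R, (t0 + r)%R]%classic; split.
    - exact: measurable_itv.
    - move=> t t01' Ut; rewrite /= in_itv/= -ler_distl.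
      apply: (le_trans (fs _ _ t01' t01)); rewrite ler_pM2l//.
      by apply: ge0_ler_powR; rewrite ?nnegrE ?fine_ge0// fD.
    - rewrite lebesgue_measure_itv/= lte_fin; case: ifPn => [_|_].
        by rewrite -EFinD -EFinM lee_fin /r; lra.
      by rewrite mule_ge0// lee_fin ?powR_ge0// mulrn_wge0// ltW.
  exists set0; split => //.
    by move=> t t01 Ut0; apply: Ut; exists t.
  by rewrite measure0 mule_ge0 ?ediam_pow_ge0// lee_fin mulrn_wge0// ltW.
have : lebesgue_measure (`[0%R, 1%R[%classic : set R) <=
    \sum_(0 <= i <oo) lebesgue_measure (I i).
  apply: measure_sigma_subadditive.
  - by move=> i; have [] := UI i.
  - exact: measurable_itv.
  - move=> t; rewrite /= in_itv/= => t01.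
    have [i _ Ut] := AU _ (Af _ t01).
    by exists i => //; have [_ + _] := UI i; exact.
rewrite lebesgue_measure_itv/= lte_fin ltr01 sube0 => le1.
have c20 : (0 < c *+ 2)%R by rewrite pmulrn_lgt0.
rewrite -(@lee_pmul2l _ (c *+ 2)%:E)//.
rewrite -EFinM mulfV ?gt_eqF// -nneseriesZl; last first.
  by move=> i _; exact: ediam_pow_ge0.
apply: (le_trans le1); apply: lee_nneseries => // i _.
by have [] := UI i.
Qed.

End hausdorff_bounds.

(** * Lüroth expansions *)

Section luroth_map_theory.
Context {R : realType}.
Implicit Types (x y : R) (d : nat -> nat).

(** The right endpoint belongs to the interval because 1 / x is then the integer k - 1, whose floor
    plus one is k. *)
Lemma luroth_d1_eq x (k : nat) : (2 <= k)%N ->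
  k%:R^-1 < x <= (k%:R - 1)^-1 -> luroth_d1 x = k.
Proof.
case: k => [|[|k]]// _ /andP[kx xk]; congr S.
have k20 : 0 < k.+2%:R :> R by rewrite ltr0n.
have x0 : 0 < x by apply: lt_trans kx; rewrite invr_gt0.
move: xk; rewrite -natr1 addrK => xk; apply: truncn_def; apply/andP; split.
  by rewrite -[leLHS]invrK lef_pV2// posrE invr_gt0 ltr0n.
by rewrite -[ltRHS]invrK ltf_pV2// posrE invr_gt0.
Qed.

Lemma luroth_d1_bounds x : 0 < x <= 1 ->
  (2 <= luroth_d1 x)%N /\ (luroth_d1 x)%:R^-1 < x <= ((luroth_d1 x)%:R - 1)^-1.
Proof.
move=> /andP[x0 x1]; have x1' : 1 <= x^-1 by rewrite invf_ge1.
have := truncn_itv (ltW (lt_le_trans ltr01 x1')).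
have t0 : (0 < Num.truncn x^-1)%N by rewrite truncn_gt0.
rewrite /luroth_d1 => /andP[tx xt]; split => //; apply/andP; split.
  by rewrite -[ltRHS]invrK ltf_pV2// posrE ?invr_gt0.
rewrite -natr1 addrK -[leLHS]invrK lef_pV2// posrE ?invr_gt0// ltr0n//.
Qed.

Lemma luroth_d1_ge2 x : 0 < x <= 1 -> 2 <= (luroth_d1 x)%:R :> R.
Proof. by move=> /luroth_d1_bounds[+ _]; rewrite ler_nat. Qed.

(** The interval of first digit k has length 1 / (k (k - 1)), and the map stretches it affinely onto
    ]0, 1]. *)
Lemma luroth_map_bounds x : 0 < x <= 1 -> 0 < luroth_map x <= 1.
Proof.
move=> x01; have [_ /andP[]] := luroth_d1_bounds x01.
have := luroth_d1_ge2 x01; rewrite /luroth_map; set k : R := (luroth_d1 x)%:R => k2 kx xk.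
have kk : 0 < k * (k - 1) by rewrite mulr_gt0; lra.
rewrite (pmulr_rgt0 _ kk) subr_gt0 kx /= -(ler_pdivlMl _ _ kk) mulr1 lerBlDr.
suff <- : (k - 1)^-1 = (k * (k - 1))^-1 + k^-1 by [].
by field; apply/andP; split; lra.
Qed.

Lemma luroth_iter_bounds n x : 0 < x <= 1 ->
  0 < iter n luroth_map x <= 1.
Proof. by move=> x01; elim: n => //= n; exact: luroth_map_bounds. Qed.

Lemma luroth_digitS n x :
  luroth_digit n.+2 x = luroth_digit n.+1 (luroth_map x).
Proof. by rewrite /luroth_digit/= -iterS iterSr. Qed.

(** The slope k (k - 1) is at least k^2 / 2, as k >= 2. *)
Lemma luroth_dist x y : 0 < x <= 1 -> 0 < y <= 1 ->
    luroth_d1 x = luroth_d1 y ->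
  `|x - y| <= 2 * (luroth_d1 x)%:R ^- 2 * `|luroth_map x - luroth_map y|.
Proof.
move=> x01 y01 xy; have := luroth_d1_ge2 x01; rewrite /luroth_map -xy.
set k : R := (luroth_d1 x)%:R => k2.
have -> : k * (k - 1) * (x - k^-1) - k * (k - 1) * (y - k^-1) =
  k * (k - 1) * (x - y) by ring.
rewrite normrM mulrA ler_peMl//.
rewrite ger0_norm; last by rewrite mulr_ge0; lra.
have k20 : 0 < k ^+ 2 by rewrite exprn_gt0//; lra.
by rewrite mulrAC (ler_pdivlMr _ _ k20); nra.
Qed.

(** * Points with prescribed Lüroth digits *)

(** Partial sums of the Lüroth series, nested from the first digit so that the recursion follows the
    shift of digits. Digits of [d] are indexed from 0. *)
Fixpoint luroth_partial n d : R :=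
  if n is m.+1 then (d 0)%:R^-1 +
    luroth_partial m (d \o S) / ((d 0)%:R * ((d 0)%:R - 1)) else 0.

Definition luroth_sum d : R := limn (luroth_partial ^~ d).

Let ge2R d k : (forall k, 2 <= d k)%N -> 2 <= (d k)%:R :> R.
Proof. by move=> /(_ k); rewrite ler_nat. Qed.

Let weight_gt0 d : (forall k, 2 <= d k)%N ->
  0 < (d 0)%:R * ((d 0)%:R - 1) :> R.
Proof. by move=> /ge2R-/(_ 0%N) d0; rewrite mulr_gt0; lra. Qed.


(** The expression is the inverse branch of [luroth_map] for the digit [d 0]. *)
Let contract d (u : R) : (forall k, 2 <= d k)%N -> 0 <= u <= 1 ->
  (d 0)%:R^-1 <= (d 0)%:R^-1 + u / ((d 0)%:R * ((d 0)%:R - 1)) <=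
    ((d 0)%:R - 1)^-1.
Proof.
move=> d2 /andP[u0 u1]; have kk := weight_gt0 d2; have k2 := ge2R 0 d2.
rewrite lerDl divr_ge0 ?(ltW kk)//=.
have -> : ((d 0)%:R - 1)^-1 =
    (d 0)%:R^-1 + 1 / ((d 0)%:R * ((d 0)%:R - 1)) :> R.
  by field; apply/andP; split; lra.
by rewrite lerD2l ler_pM2r ?invr_gt0.
Qed.

Lemma luroth_partial_itv n d : (forall k, 2 <= d k)%N ->
  0 <= luroth_partial n d <= 1.
Proof.
elim: n d => [|n IH] d d2 /=; first by rewrite lexx ler01.
have /andP[p0 p1] := contract d2 (IH (d \o S) (fun k => d2 k.+1)).
have k2 := ge2R 0 d2; apply/andP; split.
  by apply: le_trans p0; rewrite invr_ge0.
by apply: (le_trans p1); rewrite invf_le1; lra.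
Qed.

Lemma luroth_partial_nondecreasing d : (forall k, 2 <= d k)%N ->
  nondecreasing_seq (luroth_partial ^~ d).
Proof.
move=> d2; apply/nondecreasing_seqP => n; elim: n d d2 => [|n IH] d d2.
  by have /andP[] := luroth_partial_itv 1 d2.
rewrite [leLHS]/= [leRHS]/= lerD2l ler_pM2r ?invr_gt0 ?weight_gt0//.
by apply: IH => k; exact: d2.
Qed.

Lemma cvg_luroth_partial d : (forall k, 2 <= d k)%N ->
  luroth_partial n d @[n --> \oo] --> luroth_sum d.
Proof.
move=> d2; apply: nondecreasing_is_cvgn.
  exact: luroth_partial_nondecreasing.
by exists 1 => _ [n _ <-]; have /andP[] := luroth_partial_itv n d2.
Qed.

Lemma luroth_sumE d : (forall k, 2 <= d k)%N ->
  luroth_sum d =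
    (d 0)%:R^-1 + luroth_sum (d \o S) / ((d 0)%:R * ((d 0)%:R - 1)).
Proof.
move=> d2.
have lhs : luroth_partial n.+1 d @[n --> \oo] --> luroth_sum d.
  by have := cvg_luroth_partial d2; rewrite -cvg_shiftS.
rewrite -(cvg_lim (@Rhausdorff R) lhs).
apply: cvg_lim; first exact: Rhausdorff.
apply: cvgD; first exact: cvg_cst.
by apply: cvgMl; apply: cvg_luroth_partial => k; exact: d2.
Qed.

(** Limits of partial sums only give closed bounds. Applied to the shifted sequence these make the
    tail positive, whence the strict inequality. *)
Lemma luroth_sum_bounds d : (forall k, 2 <= d k)%N ->
  (d 0)%:R^-1 < luroth_sum d <= ((d 0)%:R - 1)^-1.
Proof.
have L01 e : (forall k, 2 <= e k)%N -> 0 <= luroth_sum e <= 1.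
  move=> e2; have cv := cvg_luroth_partial e2; apply/andP; split.
    apply: limr_ge; first exact: cv.
    near=> n.
    by have /andP[] := luroth_partial_itv n e2.
  apply: limr_le; first exact: cv.
  near=> n.
  by have /andP[] := luroth_partial_itv n e2.
have lb e : (forall k, 2 <= e k)%N ->
    (e 0)%:R^-1 <= luroth_sum e <= ((e 0)%:R - 1)^-1.
  by move=> e2; rewrite luroth_sumE//; apply: contract => //; apply: L01 => k;
  exact: e2.
move=> d2; have d2' k : (2 <= (d \o S) k)%N by exact: d2.
have /andP[_ ->] := lb _ d2; rewrite andbT luroth_sumE// ltrDl.
rewrite divr_gt0 ?weight_gt0//; have /andP[+ _] := lb _ d2'.
by apply: lt_le_trans; rewrite invr_gt0; have := ge2R 0 d2'; lra.
Unshelve. all: by end_near. Qed.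

Lemma luroth_sum_itv d : (forall k, 2 <= d k)%N -> 0 < luroth_sum d <= 1.
Proof.
move=> d2; have /andP[d0 d1] := luroth_sum_bounds d2; have k2 := ge2R 0 d2.
apply/andP; split; first by apply: lt_trans d0; rewrite invr_gt0; lra.
by apply: (le_trans d1); rewrite invf_le1; lra.
Qed.

Lemma luroth_d1_sum d : (forall k, 2 <= d k)%N -> luroth_d1 (luroth_sum d) = d 0.
Proof. by move=> d2; apply: luroth_d1_eq => //; exact: luroth_sum_bounds. Qed.

Lemma luroth_map_sum d : (forall k, 2 <= d k)%N ->
  luroth_map (luroth_sum d) = luroth_sum (d \o S).
Proof.
move=> d2; rewrite /luroth_map luroth_d1_sum// luroth_sumE// addrAC subrr add0r.
by rewrite mulrC divfK// gt_eqF// weight_gt0.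
Qed.

Lemma luroth_digit_sum d n : (forall k, 2 <= d k)%N ->
  luroth_digit n.+1 (luroth_sum d) = d n.
Proof.
elim: n d => [|n IH] d d2; first by rewrite /luroth_digit /= luroth_d1_sum.
rewrite luroth_digitS luroth_map_sum// IH// => k.
exact: d2.
Qed.

(* With all digits at least 3 the tails are at most 1/2, so that the point coded
   by [e] stays in the left half of its cylinder, away from that of [d]. *)
Lemma luroth_sum_sep0 d e : (forall k, 3 <= d k)%N -> (forall k, 3 <= e k)%N ->
  (d 0 < e 0)%N ->
  (e 0 - d 0)%:R / (2 * (d 0)%:R * (e 0)%:R) <= luroth_sum d - luroth_sum e.
Proof.
move=> d3 e3 de.
have d2 k : (2 <= d k)%N by exact: leq_trans (d3 k).
have e2 k : (2 <= e k)%N by exact: leq_trans (e3 k).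
have e2' k : (2 <= (e \o S) k)%N by exact: e2.
have /andP[/ltW Ld _] := luroth_sum_bounds d2.
have /andP[_ Le] := luroth_sum_bounds e2'.
have Le2 : luroth_sum (e \o S) <= 2^-1.
  apply: (le_trans Le); rewrite lef_pV2 ?posrE//=.
    have : 3 <= (e 1)%:R :> R by rewrite ler_nat.
    lra.
  have : 3 <= (e 1)%:R :> R by rewrite ler_nat.
  lra.
rewrite (luroth_sumE e2) natrB ?(ltnW de)//.
have a2 := ge2R 0 d2; have b2 := ge2R 0 e2.
have ab : (d 0)%:R + 1 <= (e 0)%:R :> R by rewrite natr1 ler_nat.
move: a2 b2 ab Ld Le2; set a : R := (d 0)%:R; set b : R := (e 0)%:R.
set u := luroth_sum (e \o S); set v := luroth_sum d => a2 b2 ab Ld u2.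
apply: (@le_trans _ _ (a^-1 - (b^-1 + 2^-1 / (b * (b - 1))))); last first.
  apply: lerB => //; rewrite lerD2l ler_pM2r// invr_gt0 mulr_gt0; lra.
(* The second fraction is nonnegative because b >= a + 1. *)
have -> : a^-1 - (b^-1 + 2^-1 / (b * (b - 1))) =
    (b - a) / (2 * a * b) + ((b - a) * (b - 1) - a) / (2 * a * b * (b - 1)).
  by field; apply/and3P; split; lra.
rewrite lerDl divr_ge0//; first by nra.
by rewrite !mulr_ge0//; lra.
Qed.

(** A common digit k scales the difference by 1 / (k (k - 1)) >= b^-2; [luroth_sum_sep0] handles the
    first place where the digits differ. The smaller digit gives the larger point. *)
Lemma luroth_sum_sep n (b : nat -> R) d e :
  (forall k, 3 <= d k)%N -> (forall k, 3 <= e k)%N ->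
  (forall k, (d k)%:R <= b k) -> (forall k, (e k)%:R <= b k) ->
  (forall k, (k < n)%N -> d k = e k) -> (d n < e n)%N ->
  (e n - d n)%:R / 2 * \prod_(k < n.+1) b k ^- 2 <=
    luroth_sum d - luroth_sum e.
Proof.
elim: n b d e => [|n IH] b d e d3 e3 db eb de dn.
  apply: le_trans (luroth_sum_sep0 d3 e3 dn).
  have d0 : 3 <= (d 0)%:R :> R by rewrite ler_nat.
  have e0 : 3 <= (e 0)%:R :> R by rewrite ler_nat.
  rewrite -(mulrA 2) invfM (mulrA _ 2^-1) big_ord_recl big_ord0 mulr1.
  have b0 : 0 < b 0%N by apply: lt_le_trans (db 0%N); lra.
  have de0 : 0 < (d 0)%:R * (e 0)%:R :> R by rewrite mulr_gt0; lra.
  rewrite ler_wpM2l ?divr_ge0// lef_pV2 ?posrE ?exprn_gt0//.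
  by rewrite expr2 ler_pM.
have d2 k : (2 <= d k)%N by exact: leq_trans (d3 k).
have e2 k : (2 <= e k)%N by exact: leq_trans (e3 k).
have d0 : 3 <= (d 0)%:R :> R by rewrite ler_nat.
have b0 := db 0%N.
have bk k : 0 <= b k by apply: le_trans (db k).
rewrite (luroth_sumE d2) (luroth_sumE e2) -(de 0%N)// opprD addrACA subrr add0r.
rewrite -mulrBl big_ord_recl mulrCA ler_pdivlMr ?weight_gt0// mulrAC.
apply: le_trans (IH (b \o S) (d \o S) (e \o S) (fun k => d3 k.+1)
  (fun k => e3 k.+1) (fun k => db k.+1) (fun k => eb k.+1)
  (fun k => de k.+1) dn); rewrite ler_piMl//.
  by rewrite mulr_ge0 ?divr_ge0// prodr_ge0// => k _; rewrite invr_ge0 exprn_ge0.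
rewrite mulrC ler_pdivrMr ?mul1r; last by rewrite exprn_gt0//; lra.
by rewrite /=; nra.
Qed.

End luroth_map_theory.

(** * Upper bound *)

Section partial_sums.
Context {R : realType}.
Implicit Types (p : nat -> R).

Lemma sum_affine p (a b : R) n :
  \sum_(k < n) (a * p k + b) = a * \sum_(k < n) p k + n%:R * b.
Proof.
by rewrite big_split/= -mulr_sumr sumr_const card_ord mulr_natl.
Qed.

Lemma sum_superlinear p (K : R) : (forall k, 0 <= p k) ->
  p k @[k --> \oo] --> +oo -> \forall n \near \oo,
    n.+1%:R * K <= \sum_(k < n) p k.
Proof.
move=> p0 /cvgryPge/(_ (`|K| *+ 2))[N _ NK]; near=> n.
have nN : (N <= n)%N by near: n; exact: nbhs_infty_ge.
(* From here on 2 (n - N) >= n + 1, so the terms from N on, each at least 2 |K|, suffice. *)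
have nN2 : (N.*2.+1 <= n)%N by near: n; exact: nbhs_infty_ge.
rewrite -(big_mkord xpredT) (big_cat_nat _ nN)//=.
apply: (@le_trans _ _ (\sum_(N <= k < n) (`|K| *+ 2))); last first.
  apply: (@le_trans _ _ (\sum_(N <= k < n) p k)); last first.
    by rewrite lerDr sumr_ge0.
  by rewrite big_nat_cond [leRHS]big_nat_cond; apply: ler_sum => k;
    rewrite andbT => /andP[Nk _]; exact: NK.
rewrite sumr_const_nat -[leRHS]mulr_natl natrB// -(mulr_natl `|K|).
apply: (@le_trans _ _ (n.+1%:R * `|K|)); first by rewrite ler_wpM2l// ler_norm.
rewrite mulrA ler_wpM2r//.
have : (N.*2.+1)%:R <= n%:R :> R by rewrite ler_nat.
by rewrite -!natr1 -mul2n natrM; lra.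
Unshelve. all: by end_near. Qed.

End partial_sums.

(** * Covers of E(psi) by cylinders *)

Section upper_bound.
Context {R : realType}.
Implicit Types (x y : R) (psi : nat -> R).

(** The interval ]0, r] is pulled back along all admissible choices of n digits. Induction prepends
    the first digit: there are at most exp([hi 0]) choices d, each contracting by 2 / d^2 <= exp(1 -
    2 [lo 0]). *)
Lemma luroth_cover n (lo hi : nat -> R) (r : R) : 0 <= r ->
  exists l : seq (set R),
  [/\ (size l)%:R <= expR (\sum_(k < n) hi k),
      (forall U, U \in l -> forall x y, U x -> U y ->
         `|x - y| <= expR (\sum_(k < n) (1 - 2 * lo k)) * r) &
      (forall x, 0 < x <= 1 ->
         (forall k, (k < n)%N ->
            expR (lo k) <= (luroth_digit k.+1 x)%:R <= expR (hi k)) ->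
         iter n luroth_map x <= r -> exists2 U, U \in l & U x)].
Proof.
move=> r0; elim: n lo hi => [|n IH] lo hi.
  exists [:: [set x | 0 < x <= r]]; split.
  - by rewrite big_ord0 expR0.
  - move=> U; rewrite inE => /eqP -> x y /= /andP[x0 xr] /andP[y0 yr].
    by rewrite big_ord0 expR0 mul1r ler_norml; apply/andP; split; lra.
  - move=> x /andP[x0 _] _ xr; exists [set x | 0 < x <= r] => /=.
      by rewrite inE.
    by rewrite x0.
have [l [lsize ldiam lcov]] := IH (lo \o S) (hi \o S).
(* The lower bound on d is built in, so that the diameter bound holds for every d in the list; sets
   with d too small are empty. *)
pose cyl (d : nat) (U : set R) := [set x | [/\ 0 < x <= 1, luroth_d1 x = d,
  expR (lo 0) <= d%:R & U (luroth_map x)]].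
exists [seq cyl d U | d <- iota 1 (Num.truncn (expR (hi 0))), U <- l]; split.
- rewrite size_allpairs size_iota natrM big_ord_recl expRD ler_pM//.
  by rewrite truncn_le expR_ge0.
- move=> _ /allpairsP[[d U] /= [_ Ul ->]] x y.
  move=> [x01 xd lod Ux] [y01 yd _ Uy].
  have xy : luroth_d1 x = luroth_d1 y by rewrite xd yd.
  apply: (le_trans (luroth_dist x01 y01 xy)).
  rewrite big_ord_recl expRD -[leRHS]mulrA ler_pM//; last exact: (ldiam _ Ul).
  have lo0 := expR_gt0 (lo 0).
  rewrite xd expRD expRN expRM_natl ler_pM//.
    by have := expR_ge1Dx (1 : R); lra.
  rewrite lef_pV2 ?posrE ?exprn_gt0//; last exact: lt_le_trans lod.
  by rewrite ler_pXn2r ?nnegrE// ltW.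
- move=> x x01 dx xr; have /andP[d0 d1] := dx 0%N isT.
  have x01' := luroth_map_bounds x01.
  have [k kn||U Ul Ux] := lcov _ x01'.
  + by rewrite -luroth_digitS//; exact: dx.
  + by rewrite -iterSr.
  exists (cyl (luroth_d1 x) U); last by split.
  apply: allpairs_f => //; rewrite mem_iota add1n ltnS /=.
  by rewrite truncn_ge_nat ?expR_ge0.
Qed.

(** With y the iterate and k its first digit, y <= 1 / (k - 1) <= 2 / k <= exp(1 - a). *)
Lemma iter_luroth_map_le n x (a : R) : 0 < x <= 1 ->
  expR a <= (luroth_digit n.+1 x)%:R -> iter n luroth_map x <= expR (1 - a).
Proof.
move=> /(luroth_iter_bounds n) y01; rewrite /luroth_digit/=.
have [_ /andP[_ yd]] := luroth_d1_bounds y01.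
have := luroth_d1_ge2 y01; move: yd.
set k : R := (luroth_d1 _)%:R => yd k2 ak; apply: (le_trans yd).
have a0 := expR_gt0 a.
have e2 : 2 <= expR 1 :> R by have := expR_ge1Dx (1 : R); lra.
rewrite expRD expRN -[leLHS]mul1r ler_pdivrMr; last lra.
by rewrite mulrAC ler_pdivlMr// mul1r; nra.
Qed.

(** The constant C replaces the threshold of the limit, which depends on the point; E(psi) then lies
    in a countable union of sets with uniform digit bounds. *)
Definition luroth_near psi (eps : R) (C : nat) : set R :=
  [set x | 0 < x <= 1 /\ forall k, (0 < k)%N ->
    `|ln (luroth_digit k x)%:R - psi k| <= eps * psi k + C%:R].

Lemma luroth_E_near psi eps : (forall n, (1 <= n)%N -> 0 < psi n) -> 0 < eps ->
  luroth_E psi `<=` \bigcup_C luroth_near psi eps C.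
Proof.
move=> psi0 eps0 x [x01 xpsi].
have /cvgrPdist_le/(_ _ eps0)[N _ NP] := xpsi.
pose g k := `|ln (luroth_digit k x)%:R - psi k|.
(* C dominates the errors of the finitely many digits before N. *)
exists (Num.truncn (\sum_(k < N) g k)).+1 => //; split => // k k0.
have pk := psi0 _ k0.
rewrite -/(g k); have [Nk|kN] := leqP N k.
  have := NP _ Nk; rewrite /= distrC -(ler_pM2r pk) -{2}(gtr0_norm pk) -normrM.
  by rewrite mulrBl mul1r divfK ?gt_eqF// -/(g k) => /le_trans; apply; rewrite lerDl.
apply: (@le_trans _ _ (\sum_(k < N) g k)).
  by rewrite (bigD1 (Ordinal kN))//= lerDl sumr_ge0// => i _; exact: normr_ge0.
rewrite ler_wpDl ?mulr_ge0 ?ltW//.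
have S0 : 0 <= \sum_(k < N) g k by apply: sumr_ge0 => i _; exact: normr_ge0.
by have /andP[] := truncn_itv S0.
Qed.

(** To be used with 1 / s < h < 2 + eta. At the recurring n, a cover by about exp((1 + eps) S_n)
    sets of diameter about exp(-(1 - eps) h S_n) has small s-sum. *)
Lemma hausdorff_measure_luroth_E psi (s h : R) :
  (forall n, (1 <= n)%N -> 0 < psi n) -> psi n @[n --> \oo] --> +oo ->
  0 < s -> 1 < s * h ->
  (forall N, exists2 n, (N <= n)%N &
    h * \sum_(k < n) psi k.+1 <= 2 * \sum_(k < n) psi k.+1 + psi n.+1) ->
  hausdorff_measure s (luroth_E psi) = 0%E.
Proof.
move=> psi0 psioo s0 sh freq; apply: hausdorff_measure_eq0 => delta delta0.
(* Chosen so that (1 + eps) - (1 - eps) s h = - (s h - 1) / 2. *)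
pose eps := (s * h - 1) / (2 * (1 + s * h)).
have den0 : 0 < 2 * (1 + s * h) by lra.
have eps0 : 0 < eps by rewrite divr_gt0; lra.
have eps2 : eps <= 2^-1 by rewrite ler_pdivrMr; lra.
have epsE : eps * (1 + s * h) = (s * h - 1) / 2 by rewrite /eps; field; lra.
apply/eqP; rewrite eq_le hausdorff_premeasure_ge0 andbT.
suff null C : hausdorff_premeasure s delta (luroth_near psi eps C) = 0%E.
  rewrite -(hausdorff_premeasure_bigcup0 null).
  apply: ereal_inf_le_tmp => _ [U [cov dU] <-]; exists U => //; split => //.
  exact: subset_trans (luroth_E_near psi0 eps0) cov.
apply/eqP; rewrite eq_le hausdorff_premeasure_ge0 andbT.
apply/lee_addgt0Pr => e e0; rewrite add0e.
pose c := (s * h - 1) / 2; have c0 : 0 < c by rewrite divr_gt0; lra.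
pose K := C%:R + s * (1 + 2 * C%:R).
pose p k := psi k.+1.
have p0 k : 0 <= p k by apply/ltW/psi0.
have poo : p k @[k --> \oo] --> +oo by rewrite (cvg_shiftS psi).
(* [N1] will make the s-sum of the cover at most e, and [N2] its diameters at most [delta]. [K]
   gathers the constants contributed by each digit. *)
have [N1 _ NN1] := sum_superlinear ((K + `|ln e|) / c) p0 poo.
have [N2 _ NN2] := sum_superlinear (1 + 2 * C%:R + `|ln delta|) p0 poo.
have [n nN hn] := freq (maxn N1 N2).
have {NN1} S1 := NN1 n (leq_trans (leq_maxl _ _) nN).
have {NN2} S2 := NN2 n (leq_trans (leq_maxr _ _) nN).
pose lo k := (1 - eps) * p k - C%:R.
pose hi k := (1 + eps) * p k + C%:R.
have [l [lsize ldiam lcov]] := luroth_cover n lo hi (expR_ge0 (1 - lo n)).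
move: ldiam lsize; rewrite -expRD.
rewrite (eq_bigr (fun k : 'I_n => - (2 * (1 - eps)) * p k + (1 + 2 * C%:R))); last first.
  by move=> k _; rewrite /lo; ring.
rewrite !sum_affine; move: S1 S2 hn; rewrite /= -/(p n); set Sn := \sum_(k < n) _.
move=> S1 S2 hn ldiam lsize.
(* [Q] is the logarithm of the diameter bound; it includes the term 1 - [lo n] due to the digit of
   index n + 1. *)
set Q := (X in expR X) in ldiam.
have n1 : 1 <= n.+1%:R :> R by rewrite ler1n.
have C0 : 0 <= C%:R :> R by [].
have nn : n.+1%:R = n%:R + 1 :> R by rewrite natr1.
have nn0 : 0 <= n%:R :> R by [].
have pn0 := p0 n.
have Sn0 : 0 <= Sn by apply: sumr_ge0 => k _; exact: p0.
have Qdelta : Q <= - `|ln delta|.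
  have : `|ln delta| <= n.+1%:R * `|ln delta| by rewrite ler_peMl.
  have : 0 <= (1 - eps) * p n by rewrite mulr_ge0//; lra.
  have : 0 <= (2^-1 - eps) * Sn by rewrite mulr_ge0//; lra.
  have : 0 <= n%:R * C%:R :> R by rewrite mulr_ge0.
  by move: S2; rewrite /Q /lo nn; lra.
(* The left side is the logarithm of the bound on the number of sets times the diameter bound to the
   power s. *)
have Qe : (1 + eps) * Sn + n%:R * C%:R + s * Q <= - `|ln e|.
  move: S1; rewrite mulrA ler_pdivrMr// /K nn => S1.
  have : `|ln e| <= n.+1%:R * `|ln e| by rewrite ler_peMl.
  have : 0 <= (1 - eps) * s * (2 * Sn + p n - h * Sn).
    by rewrite mulr_ge0 ?subr_ge0// mulr_ge0 ?(ltW s0)//; lra.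
  have : 0 <= s * (n%:R * C%:R) by rewrite !mulr_ge0// ltW.
  have : 0 <= s * C%:R by rewrite mulr_ge0// ltW.
  have : eps * (1 + s * h) * Sn = (s * h - 1) / 2 * Sn by rewrite epsE.
  by move: S1; rewrite /c /Q /lo nn; lra.
apply: le_trans (hausdorff_premeasure_finite_cover (ltW s0) _ ldiam _) _.
- rewrite expR_ge0/= -[leRHS]lnK ?posrE// ler_expR.
  by apply: (le_trans Qdelta); rewrite lerNl -normrN ler_norm.
- move=> x [x01 xnear].
  have dig k : expR (lo k) <= (luroth_digit k.+1 x)%:R <= expR (hi k).
    have d0 : 0 < (luroth_digit k.+1 x)%:R :> R by rewrite ltr0n.
    have := xnear k.+1 isT; rewrite -/(p k) ler_distl => /andP[lk hk].
    rewrite -[X in _ <= X <= _]lnK ?posrE// !ler_expR /lo /hi.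
    by apply/andP; split; lra.
  apply: lcov => //; apply: iter_luroth_map_le => //.
  by have /andP[] := dig n.
- rewrite lee_fin -expRM.
  apply: (@le_trans _ _ (expR ((1 + eps) * Sn + n%:R * C%:R) * expR (Q * s))).
    by rewrite ler_wpM2r ?expR_ge0.
  rewrite -expRD -[leRHS]lnK ?posrE// ler_expR (mulrC Q); apply: (le_trans Qe).
  by rewrite lerNl -normrN ler_norm.
Qed.

End upper_bound.

(** * Lower bound *)

Section mixed_radix.
Context {R : realType}.
Context (m : nat -> nat) (m_ge2 : forall k, (2 <= m k)%N).
Implicit Types (t u : R).

Let M n := (\prod_(k < n) m k)%N.

Let M_gt0 n : (0 < M n)%N.
Proof. by rewrite prodn_gt0// => k; exact: leq_trans (m_ge2 k). Qed.

(** For t in [0, 1[, the integer written by the first n digits of t. *)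
Definition mixed_radix_trunc n t : nat := Num.truncn ((M n)%:R * t).

Definition mixed_radix_digit n t : nat := mixed_radix_trunc n.+1 t %% m n.

Lemma mixed_radix_digit_lt n t : (mixed_radix_digit n t < m n)%N.
Proof. by rewrite ltn_mod (leq_trans _ (m_ge2 n)). Qed.

Lemma truncn_mulr_divn (k : nat) (x : R) : (0 < k)%N -> 0 <= x ->
  (Num.truncn (k%:R * x) %/ k)%N = Num.truncn x.
Proof.
move=> k0 x0; have kx0 : 0 <= k%:R * x by rewrite mulr_ge0.
have /andP[qx xq] := truncn_itv x0; have /andP[Nx _] := truncn_itv kx0.
have kR : 0 < k%:R :> R by rewrite ltr0n.
apply/eqP; rewrite eqn_leq leq_divRL// -ltnS ltn_divLR//; apply/andP; split.
  by rewrite -(ltr_nat R) (le_lt_trans Nx)// natrM mulrC ltr_pM2r.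
by rewrite truncn_ge_nat// natrM mulrC ler_pM2l.
Qed.

Lemma mixed_radix_truncS n t : 0 <= t ->
  mixed_radix_trunc n.+1 t =
    (mixed_radix_trunc n t * m n + mixed_radix_digit n t)%N.
Proof.
move=> t0; rewrite [LHS](divn_eq _ (m n)); congr (_ * _ + _)%N.
rewrite /mixed_radix_trunc {1}/M big_ord_recr/= mulnC natrM -mulrA.
rewrite truncn_mulr_divn//; first exact: leq_trans (m_ge2 n).
by rewrite mulr_ge0.
Qed.

Lemma mixed_radix_trunc_eq n t u : 0 <= t < 1 -> 0 <= u < 1 ->
  (forall k, (k < n)%N -> mixed_radix_digit k t = mixed_radix_digit k u) ->
  mixed_radix_trunc n t = mixed_radix_trunc n u.
Proof.
move=> /andP[t0 t1] /andP[u0 u1]; elim: n => [_|n IH tu].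
  have q0 v : 0 <= v -> v < 1 -> mixed_radix_trunc 0 v = 0%N.
    move=> v0 v1; rewrite /mixed_radix_trunc /M big_ord0 mul1r.
    by apply: truncn_def; rewrite v0 v1.
  by rewrite !q0.
rewrite !mixed_radix_truncS// tu// IH// => k kn.
by apply: tu; exact: leqW.
Qed.

(** Multiplied by [M n.+1], the two numbers have floors that differ by j >= 1, so they differ by at
    most j + 1 <= 2 j. *)
Lemma mixed_radix_dist n t u : 0 <= t < 1 -> 0 <= u < 1 ->
  (forall k, (k < n)%N -> mixed_radix_digit k t = mixed_radix_digit k u) ->
  (mixed_radix_digit n t < mixed_radix_digit n u)%N ->
  `|t - u| <= 2 * (mixed_radix_digit n u - mixed_radix_digit n t)%:R
    / (M n.+1)%:R.
Proof.
move=> t01 u01 tu tun; have tuq := mixed_radix_trunc_eq t01 u01 tu.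
case/andP: t01 => t0 t1; case/andP: u01 => u0 u1.
have M0 : 0 < (M n.+1)%:R :> R by rewrite ltr0n.
have /andP[] := truncn_itv (mulr_ge0 (ltW M0) t0).
have /andP[] := truncn_itv (mulr_ge0 (ltW M0) u0).
rewrite -/(mixed_radix_trunc n.+1 t) -/(mixed_radix_trunc n.+1 u).
rewrite !mixed_radix_truncS// tuq -!natr1 !natrD natrB ?(ltnW tun)//.
have : (mixed_radix_digit n t)%:R + 1 <= (mixed_radix_digit n u)%:R :> R.
  by rewrite natr1 ler_nat.
move=> ? ? ? ? ?; rewrite ler_pdivlMr// -[X in _ * X](gtr0_norm M0) -normrM.
by rewrite ler_norml mulrBl; apply/andP; split; lra.
Qed.

Lemma mixed_radix_inj t u : 0 <= t < 1 -> 0 <= u < 1 ->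
  mixed_radix_digit ^~ t =1 mixed_radix_digit ^~ u -> t = u.
Proof.
move=> t01 u01 tu; apply/eqP; rewrite -subr_eq0 -normr_le0 leNgt; apply/negP.
(* Equal floors force [M n] r <= 1, whereas [M n] >= 2^n > n > 1 / r. *)
set r := `|t - u| => r0; pose n := (Num.truncn r^-1).+1.
have tuq := mixed_radix_trunc_eq t01 u01 (fun k (_ : (k < n)%N) => tu k).
case/andP: t01 => t0 t1; case/andP: u01 => u0 u1.
have M0 : 0 < (M n)%:R :> R by rewrite ltr0n.
have /andP[] := truncn_itv (mulr_ge0 (ltW M0) t0).
have /andP[] := truncn_itv (mulr_ge0 (ltW M0) u0).
rewrite -/(mixed_radix_trunc n t) -/(mixed_radix_trunc n u) tuq -natr1.
move=> qu uq qt tq.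
have : (M n)%:R * r <= 1.
  rewrite -[X in X * _](gtr0_norm M0) /r -normrM ler_norml mulrBr.
  by apply/andP; split; lra.
apply/negP; rewrite -ltNge -ltr_pdivrMr// mul1r.
have r1 : 0 <= r^-1 by rewrite invr_ge0 ltW.
have /andP[_ rn] := truncn_itv r1; apply: (lt_le_trans rn).
rewrite -/n ler_nat (leq_trans (ltnW (ltn_expl n (isT : (1 < 2)%N))))//.
rewrite /M -[X in (_ ^ X)%N]card_ord -prod_nat_const.
by apply: leq_prod => k _.
Qed.

Lemma mixed_radix_first_diff t u : 0 <= t < 1 -> 0 <= u < 1 -> t != u ->
  exists2 n, mixed_radix_digit n t != mixed_radix_digit n u &
    forall k, (k < n)%N -> mixed_radix_digit k t = mixed_radix_digit k u.
Proof.
move=> t01 u01 tu.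
have ex : exists n, mixed_radix_digit n t != mixed_radix_digit n u.
  apply: contrapT => nex; case/eqP: tu; apply: mixed_radix_inj => // k.
  by apply/eqP; apply: contrapT => /negP kk; apply: nex; exists k.
case: (ex_minnP ex) => n ndiff nmin; exists n => // k kn.
by apply/eqP; apply: contraTT kn => /nmin; rewrite -leqNgt.
Qed.

End mixed_radix.

(** * A copy of [0, 1[ inside E(psi) *)

Section lower_bound.
Context {R : realType}.
Implicit Types (psi p : nat -> R).

(** Adding 3 puts the radix above exp(p k) and makes all coded digits at least 3, as
    [luroth_sum_sep] requires. *)
Definition luroth_base p k : nat := (Num.truncn (expR (p k))).+3.

(** With y = exp(p k) >= 1, twice the radix is at most 2 (y + 3) <= 8 y <= exp(3) y. The factor 2 is
    there because coded digits stay below twice the radix. *)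
Lemma luroth_base_bounds p k : 0 <= p k ->
  expR (p k) <= (luroth_base p k)%:R /\
  2 * (luroth_base p k)%:R <= expR (p k + 3).
Proof.
move=> p0; have /andP[tp pt] := truncn_itv (expR_ge0 (p k)).
have p1 : 1 <= expR (p k) by rewrite -[leLHS]expR0 ler_expR.
have e1 : 2 <= expR 1 :> R by have := expR_ge1Dx (1 : R); lra.
have e3 : 8 <= expR 3 :> R.
  rewrite -[X in expR X]mulr1 expRM_natl.
  have : 2 * 2 * 2 <= expR 1 * expR 1 * expR 1 :> R by rewrite !ler_pM.
  by rewrite !exprS expr0 mulr1 mulrA; lra.
have -> : (luroth_base p k)%:R = (Num.truncn (expR (p k)))%:R + 3 :> R.
  by rewrite /luroth_base -addn3 natrD.
move: pt; rewrite -natr1 => pt; split; first lra.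
have : expR (p k) * 8 <= expR (p k) * expR 3 by rewrite ler_wpM2l// expR_ge0.
by rewrite -expRD; lra.
Qed.

Definition luroth_code p (t : R) : nat -> nat :=
  fun k => (luroth_base p k + mixed_radix_digit (luroth_base p) k t)%N.

Lemma luroth_base_ge2 p k : (2 <= luroth_base p k)%N. Proof. by []. Qed.

Lemma luroth_code_bounds p t k : 0 <= p k ->
  expR (p k) <= (luroth_code p t k)%:R <= expR (p k + 3).
Proof.
move=> /luroth_base_bounds[pb bp]; apply/andP; split.
  by apply: (le_trans pb); rewrite ler_nat leq_addr.
apply: le_trans bp; rewrite -natrM ler_nat mul2n -addnn leq_add2l ltnW//.
exact/mixed_radix_digit_lt/luroth_base_ge2.
Qed.

Lemma luroth_code_ge3 p t k : (3 <= luroth_code p t k)%N. Proof. by []. Qed.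

Lemma luroth_code_E psi t : (forall n, (1 <= n)%N -> 0 < psi n) ->
  psi n @[n --> \oo] --> +oo ->
  luroth_E psi (luroth_sum (luroth_code (psi \o S) t)).
Proof.
move=> psi0 psioo.
have code2 k : (2 <= luroth_code (psi \o S) t k)%N by [].
split; first exact: luroth_sum_itv.
rewrite -(cvg_shiftS (fun n => ln (luroth_digit n _)%:R / psi n)).
apply/cvgrPdist_le => e e0; near=> n; rewrite /= luroth_digit_sum//.
have : 3 / e <= psi n.+1.
  near: n; have : psi n.+1 @[n --> \oo] --> +oo by rewrite (cvg_shiftS psi).
  by move/cvgryPge; exact.
have pn := psi0 n.+1 isT; rewrite ler_pdivrMr// => ep.
have /andP[] := luroth_code_bounds t (ltW pn : 0 <= (psi \o S) n).
set d : R := (luroth_code _ _ _)%:R => pd dp.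
have d0 : 0 < d := lt_le_trans (expR_gt0 _) pd.
move: pd dp; rewrite -[d]lnK ?posrE// !ler_expR lnK ?posrE//= => pd dp.
rewrite distrC -[X in _ - X](divff (lt0r_neq0 pn)) -mulrBl normrM.
rewrite (gtr0_norm (_ : 0 < (psi n.+1)^-1)) ?invr_gt0// ler_pdivrMr//.
by rewrite mulrC ger0_norm; lra.
Unshelve. all: by end_near. Qed.

(** The hypothesis compares, for each first place n of difference, the logarithms of both distances;
    7 (n + 1) absorbs all constants of the separation bound. *)
Lemma luroth_code_holder p (s K : R) t u : (forall k, 0 <= p k) ->
  0 <= s <= 1 ->
  (forall n, s * (2 * \sum_(k < n) p k + p n + 7 * n.+1%:R) + 1 <=
     \sum_(k < n) p k + K) ->
  0 <= t < 1 -> 0 <= u < 1 ->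
  `|t - u| <= expR K *
    `|luroth_sum (luroth_code p t) - luroth_sum (luroth_code p u)| `^ s.
Proof.
move=> p0 /andP[s0 s1] pK t01 u01.
have [->|tu] := eqVneq t u.
  by rewrite subrr normr0 mulr_ge0 ?expR_ge0 ?powR_ge0.
have [n nd nmin] := mixed_radix_first_diff (luroth_base_ge2 p) t01 u01 tu.
wlog tu_n : t u t01 u01 {tu} nd nmin / (mixed_radix_digit (luroth_base p) n t <
    mixed_radix_digit (luroth_base p) n u)%N.
  move=> H; move: (nd); rewrite neq_ltn => /orP[|] tun; first exact: H.
  rewrite distrC [X in X `^ _]distrC; apply: H => //; first by rewrite eq_sym.
  by move=> k kn; rewrite nmin.
apply: (le_trans (mixed_radix_dist (luroth_base_ge2 p) t01 u01 nmin tu_n)).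
set j := (_ - _)%N; set A := luroth_base p n.
have [Ap _] := luroth_base_bounds (p0 n); rewrite -/A in Ap.
have A0 : 0 < A%:R :> R := lt_le_trans (expR_gt0 _) Ap.
have Sn_le : expR (\sum_(k < n) p k) <= (\prod_(k < n) luroth_base p k)%:R.
  rewrite expR_sum natr_prod; apply: ler_prod => k _.
  by rewrite expR_ge0/=; have [] := luroth_base_bounds (p0 k).
have := @luroth_sum_sep R n (fun k => expR (p k + 3)) (luroth_code p t)
  (luroth_code p u) (luroth_code_ge3 p t) (luroth_code_ge3 p u) _ _ _ _.
rewrite subnDl -/j => sep.
(* Measuring j relative to the radix [A] cancels one p n: the separation exponent becomes 2 S_n + p
   n instead of 2 S_n + 2 p n. *)
pose theta : R := j%:R / A%:R.
have j0 : (0 < j)%N by rewrite subn_gt0.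
have jA : (j <= A)%N.
  by rewrite (leq_trans (leq_subr _ _))// ltnW// mixed_radix_digit_lt.
have theta0 : 0 < theta by rewrite divr_gt0// ltr0n.
have theta1 : theta <= 1 by rewrite ler_pdivrMr// mul1r ler_nat.
have jE : j%:R = theta * A%:R by rewrite divfK// gt_eqF.
clearbody theta.
pose Sn := \sum_(k < n) p k.
(* The 6 per digit comes from squaring exp(p k + 3), and the 1 from 1 / 2 >= exp(-1). *)
pose W := - (2 * Sn + p n + 6 * n.+1%:R + 1).
have e2 : 2 <= expR 1 :> R by have := expR_ge1Dx (1 : R); lra.
apply: (@le_trans _ _ (theta * expR (1 - Sn))).
  rewrite big_ord_recr/= natrM -/A jE.
  set M : R := (\prod_(k < n) _)%:R in Sn_le *.
  have M0 : 0 < M := lt_le_trans (expR_gt0 _) Sn_le.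
  have -> : 2 * (theta * A%:R) / (M * A%:R) = theta * (2 / M).
    by field; rewrite !gt_eqF.
  by rewrite ler_pM2l// expRD expRN ler_pM ?invr_ge0 ?(ltW M0)// lef_pV2 ?posrE ?expR_gt0.
have dist_ge : theta * expR W <=
    `|luroth_sum (luroth_code p t) - luroth_sum (luroth_code p u)|.
  apply: le_trans (ler_norm _); apply: le_trans (sep _ _ _ _) => //.
  - have -> : \prod_(k < n.+1) expR (p k + 3) ^- 2 =
        expR (- 2 * (Sn + p n) + n.+1%:R * - 6).
      have -> : Sn + p n = \sum_(k < n.+1) p k by rewrite big_ord_recr.
      rewrite -sum_affine expR_sum; apply: eq_bigr => k _.
      by rewrite -expRM_natl -expRN; congr expR; ring.
    rewrite jE -!mulrA ler_pM2l// mulrA.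
    have -> : W = (p n - 1) + (- 2 * (Sn + p n) + n.+1%:R * - 6).
      by rewrite /W; ring.
    rewrite expRD ler_pM2r ?expR_gt0// expRD expRN ler_pM ?expR_ge0//.
    by rewrite lef_pV2 ?posrE ?expR_gt0.
  - by move=> k; have /andP[] := luroth_code_bounds t (p0 k).
  - by move=> k; have /andP[] := luroth_code_bounds u (p0 k).
  - by move=> k kn; rewrite /luroth_code nmin.
  - by rewrite ltn_add2l.
apply: (@le_trans _ _ (expR K * (theta * expR W) `^ s)); last first.
  rewrite ler_pM2l ?expR_gt0//; apply: ge0_ler_powR => //.
  by rewrite nnegrE mulr_ge0 ?expR_ge0// ltW.
rewrite powRM ?expR_ge0 ?(ltW theta0)// -expRM mulrCA -expRD ler_pM ?expR_ge0//.
- exact: ltW.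
(* Here s <= 1 enters: theta <= theta^s, as 0 < theta <= 1. *)
- rewrite -[leLHS]powRr1 ?(ltW theta0)//.
  by apply: ger_powR; rewrite ?theta0.
- rewrite ler_expR; have := pK n; rewrite -/Sn /W.
  have : s <= s * n.+1%:R by rewrite ler_peMr// ler1n.
  lra.
Qed.

Lemma hausdorff_measure_luroth_E_neq0 psi (s h : R) :
  (forall n, (1 <= n)%N -> 0 < psi n) -> psi n @[n --> \oo] --> +oo ->
  0 <= s <= 1 -> s * h < 1 ->
  (\forall n \near \oo,
    2 * \sum_(k < n) psi k.+1 + psi n.+1 <= h * \sum_(k < n) psi k.+1) ->
  hausdorff_measure s (luroth_E psi) != 0%E.
Proof.
move=> psi0 psioo s01 sh ev; have /andP[s0 s1] := s01.
pose p := psi \o S; have p0 k : 0 <= p k by apply/ltW/psi0.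
have poo : p k @[k --> \oo] --> +oo by rewrite (cvg_shiftS psi).
(* [g n] is the least K allowed at n in [luroth_code_holder]. It is eventually nonpositive, since (1
   - s h) S_n outgrows n, so finitely many n determine K. *)
pose g n := s * (2 * \sum_(k < n) p k + p n + 7 * n.+1%:R) + 1 -
  \sum_(k < n) p k.
have [N _ gN] : \forall n \near \oo, g n <= 0.
  near=> n.
  have : n.+1%:R * ((7 * s + 1) / (1 - s * h)) <= \sum_(k < n) p k.
    by near: n; exact: sum_superlinear.
  have : 2 * \sum_(k < n) p k + p n <= h * \sum_(k < n) p k by near: n.
  rewrite mulrA ler_pdivrMr ?subr_gt0// /g.
  set Sn := \sum_(k < n) p k => hn Sn1.
  have : 0 <= s * (h * Sn - (2 * Sn + p n)) by rewrite mulr_ge0// subr_ge0.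
  have : 1 <= n.+1%:R :> R by rewrite ler1n.
  by move: Sn1; lra.
pose K := \sum_(k < N) `|g k|.
have gK n : g n <= K.
  have [Nn|nN] := leqP N n.
    by apply: (le_trans (gN _ Nn)); apply: sumr_ge0.
  apply: (le_trans (ler_norm _)).
  by rewrite /K (bigD1 (Ordinal nN))//= lerDl sumr_ge0.
apply: (@hausdorff_measure_neq0 _ _ (expR K) _
  (fun t => luroth_sum (luroth_code p t))) => //.
- exact: expR_gt0.
- by move=> t _; exact: luroth_code_E.
- move=> t u t01 u01; apply: luroth_code_holder => // n.
  by have := gK n; rewrite /g; lra.
Unshelve. all: by end_near. Qed.

End lower_bound.

(** * Hausdorff dimension of E(psi) *)

Section limsup.
Context {R : realType}.
Local Open Scope ereal_scope.
Implicit Types (u : (\bar R)^nat) (a : \bar R).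

Lemma limn_esup_inf u : limn_esup u = ereal_inf (range (esups u)).
Proof. by rewrite limn_esup_lim; apply/cvg_lim => //; exact: cvg_esups_inf. Qed.

Lemma limn_esup_gt_freq u a N : a < limn_esup u ->
  exists2 n, (N <= n)%N & a < u n.
Proof.
move=> au; have : a < esups u N.
  apply: (lt_le_trans au); rewrite limn_esup_inf.
  by apply: ereal_inf_lbound; exists N.
by move=> /ereal_sup_gt[_ [n Nn <-]] aun; exists n.
Qed.

Lemma limn_esup_lt_near u a : limn_esup u < a -> \forall n \near \oo, u n < a.
Proof.
rewrite limn_esup_inf => /ereal_inf_lt[_ [N _ <-]] Na; exists N => // n Nn.
by apply: le_lt_trans Na; apply: ereal_sup_ubound; exists n.
Qed.

Lemma limn_esup_ge0 u : (forall n, 0 <= u n) -> 0 <= limn_esup u.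
Proof.
move=> u0; rewrite limn_esup_inf; apply: le_ereal_inf_tmp => _ [N _ <-].
by apply: (le_trans (u0 N)); apply: ereal_sup_ubound; exists N => //=.
Qed.

End limsup.

Theorem theorem1p2 (R : realType) (psi : nat -> R)
    (psi_gt0 : forall n : nat, (1 <= n)%N -> 0 < psi n)
    (psi_oo : psi n @[n --> \oo] --> +oo) :
  let eta : \bar R :=
    limn_esup (fun n => (psi n.+1 / \sum_(1 <= k < n.+1) psi k)%:E) in
  hausdorff_dim (luroth_E psi) = ((2%:E + eta)^-1)%E.
Proof.
move=> eta.
pose Sn n := \sum_(k < n) psi k.+1.
have SnE n : \sum_(1 <= k < n.+1) psi k = Sn n by rewrite big_add1 big_mkord.
have Sn_gt0 n : (0 < n)%N -> 0 < Sn n.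
  case: n => // n _; rewrite /Sn big_ord_recr/= ltr_wpDl ?psi_gt0//.
  by apply: sumr_ge0 => k _; exact/ltW/psi_gt0.
have eta_ge0 : (0 <= eta)%E.
  apply: limn_esup_ge0 => n; rewrite SnE lee_fin divr_ge0 ?(ltW (psi_gt0 _ _))//.
  by apply: sumr_ge0 => k _; exact/ltW/psi_gt0.
have eta2_ge0 : (0 <= 2%:E + eta)%E by rewrite adde_ge0// lee_fin.
apply/eqP; rewrite eq_le; apply/andP; split.
(* The inverse is 0 when eta is infinite, and 2 + eta is positive otherwise. *)
- have v_fin : ((2%:E + eta)^-1)%E \is a fin_num.
    move: eta_ge0; case: eta {eta2_ge0} => [r||]//=; rewrite ?addey// ?invey//.
    by rewrite lee_fin => r0; rewrite -EFinD inver gt_eqF//; lra.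
  apply/lee_addgt0Pr => e e0; rewrite -(fineK v_fin) -EFinD.
  set s := _ + e.
  have vs : ((2%:E + eta)^-1 < s%:E)%E by rewrite -(fineK v_fin) lte_fin ltrDl.
  clearbody s.
  have s0 : 0 < s by rewrite -lte_fin (le_lt_trans _ vs)// inve_ge0.
  apply: ereal_inf_lbound; exists s => //; split; first exact: ltW.
  (* For finite eta, h is the midpoint of 1 / s and 2 + eta. *)
  have [h sh heta] : exists2 h : R, s^-1 < h & ((h - 2)%:E < eta)%E.
    move: vs; rewrite inve_plt ?inE ?lee_fin ?(ltW s0)// inver gt_eqF//.
    case: eta eta_ge0 {eta2_ge0 v_fin s0} => [r||]//.
    - rewrite -EFinD lte_fin => _ sr; exists ((s^-1 + (2 + r)) / 2).
        by lra.
      by rewrite lte_fin; lra.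
    - by move=> _ _; exists (s^-1 + 1); rewrite ?ltry// ltrDl.
  apply: (@hausdorff_measure_luroth_E _ _ _ h) => //.
    by rewrite -(mulfV (lt0r_neq0 s0)) ltr_pM2l.
  (* Starting at N + 1 excludes n = 0, where the sum in the denominator is empty. *)
  move=> N; have [n Nn] := limn_esup_gt_freq N.+1 heta.
  rewrite SnE lte_fin ltr_pdivlMr ?Sn_gt0 ?(leq_trans _ Nn)// => hn.
  by exists n; [exact: ltnW|rewrite -/(Sn n); lra].
- apply: le_ereal_inf_tmp => _ [s [s0 Hs0] <-]; rewrite leNgt; apply/negP => sv.
  (* An infinite eta would give s < 0. *)
  have [r etar] : exists r, eta = r%:E.
    move: eta_ge0 sv; case: eta {eta2_ge0} => [r||]// _; first by exists r.
    by rewrite addey// invey lte_fin ltNge s0.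
  move: eta_ge0 sv; rewrite etar lee_fin -EFinD inver => r0.
  have r2 : 0 < 2 + r by lra.
  rewrite gt_eqF// lte_fin -div1r ltr_pdivlMr// => sr.
  (* With q = s (2 + r) < 1 and s <= 1/2, h exceeds 2 + eta while s h <= q + (1 - q) / 4 < 1. *)
  pose h := 2 + r + (1 - s * (2 + r)) / 2.
  have s1 : s <= 2^-1 by nra.
  have : hausdorff_measure s (luroth_E psi) != 0%E.
    apply: (@hausdorff_measure_luroth_E_neq0 _ _ _ h) => //.
    + by rewrite s0/=; lra.
    + by rewrite /h; nra.
    + have : (eta < (h - 2)%:E)%E by rewrite etar lte_fin /h; lra.
      move=> /limn_esup_lt_near ev; near=> n.
      have n0 : (0 < n)%N by near: n; exact: nbhs_infty_gt.
      have : ((psi n.+1 / \sum_(1 <= k < n.+1) psi k)%:E < (h - 2)%:E)%E.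
        by near: n.
      by rewrite SnE lte_fin ltr_pdivrMr ?Sn_gt0// -/(Sn n); lra.
  by rewrite Hs0 eqxx.
Unshelve. all: by end_near. Qed.
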